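(* For all integers $1\le d<\infty$ and all non-empty $v\subseteq u\subseteq\{1,\dots,d\}$, the gain coefficients of the Halton points satisfy $$\sup_{n\in\mathbb{N}}G_{v,\boldsymbol{0}}(n)\le\sup_{n\in\mathbb{N}}G_{u,\boldsymbol{0}}(n),$$ where $\boldsymbol{0}$ denotes the zero vector in $\mathbb{N}_0^v$ and $\mathbb{N}_0^u$ respectively.
   Context: $\mathbb{N}=\{1,2,\dots\}$, $\mathbb{N}_0=\mathbb{N}\cup\{0\}$. For $j\in\mathbb{N}$, $b_j$ is the $j$-th prime ($b_1=2,b_2=3,b_3=5,\dots$). For $i\in\mathbb{N}_0$ write $i=\sum_{\ell\ge1}a_{ij\ell}b_j^{\ell-1}$ with base-$b_j$ digits $a_{ij\ell}\in\{0,\dots,b_j-1\}$; the (unscrambled) Halton points are $\boldsymbol{a}_i=(a_{i1},\dots,a_{id})\in[0,1)^d$, $i\in\mathbb{N}_0$, with $a_{ij}=\sum_{\ell\ge1}a_{ij\ell}b_j^{-\ell}$. For $u\subseteq\{1,\dots,d\}$, $\mathbb{N}_0^u$ is the set of vectors $\boldsymbol{k}=(k_j)_{j\in u}$ of nonnegative integers indexed by $u$. For non-empty $u\subseteq\{1,\dots,d\}$, $\boldsymbol{k}\in\mathbb{N}_0^u$ and $n\in\mathbb{N}$, the gain coefficient is $$G_{u,\boldsymbol{k}}(n)=\frac1n\prod_{j\in u}\frac1{b_j-1}\ \sum_{i=0}^{n-1}\sum_{i'=0}^{n-1}\prod_{j\in u}\Bigl(b_j\mathbf{1}\{\lfloor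 b_j^{k_j+1}a_{ij}\rfloor=\lfloor b_j^{k_j+1}a_{i'j}\rfloor\}-\mathbf{1}\{\lfloor b_j^{k_j}a_{ij}\rfloor=\lfloor b_j^{k_j}a_{i'j}\rfloor\}\Bigr),$$ where $\mathbf{1}\{A\}$ is $1$ if $A$ holds and $0$ otherwise. *)

(* Defs.v *)
From HB Require Import structures.
From mathcomp Require Import all_boot all_order all_algebra.
From mathcomp Require Import all_classical all_reals all_analysis.
Import Order.TTheory GRing.Theory Num.Theory.
Import numFieldNormedType.Exports.

Set Implicit Arguments.
Unset Strict Implicit.
Unset Printing Implicit Defensive.

Local Open Scope ring_scope.

Lemma next_prime_subproof (m : nat) : exists p : nat, (m < p)%N && prime p.
Proof. by case: (prime_above m) => p mp pp; exists p; rewrite mp. Qed.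

Definition next_prime (m : nat) : nat := ex_minn (next_prime_subproof m).

(* The primes in increasing order, counted from 0: nth_prime 0 = 2,
   nth_prime 1 = 3, nth_prime 2 = 5. The coordinates 1, ..., d are likewise
   represented by 'I_d = {0, ..., d-1}, so that nth_prime j is the base of
   coordinate j : 'I_d. *)
Definition nth_prime (j : nat) : nat := iter j next_prime 2%N.

(* Digits are counted from 0: i = \sum_l digit b i l * b ^ l. *)
Definition digit (b i l : nat) : nat := ((i %/ b ^ l) %% b)%N.

(* With digits counted from 0, digit l has weight b ^- l.+1 in the
   base-b radical inverse of i. *)
Definition radical_inverse (R : realType) (b i : nat) : R :=
  limn (series (fun l : nat => (digit b i l)%:R / b%:R ^+ l.+1 : R)).

Definition halton (R : realType) (d i : nat) : 'rV[R]_d :=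
  \row_(j < d) radical_inverse R (nth_prime j) i.

(* A vector in N_0^u is represented by a function on all coordinates; only
   its values at j \in u are used. *)
Definition gain (R : realType) (d : nat) (u : {set 'I_d}) (k : 'I_d -> nat)
    (n : nat) : R :=
  let b (j : 'I_d) : R := (nth_prime j)%:R in
  let a (i : nat) (j : 'I_d) : R := halton R d i ord0 j in
  let same_cell (m : nat) (i i' : nat) (j : 'I_d) : bool :=
    Num.floor (b j ^+ m * a i j) == Num.floor (b j ^+ m * a i' j) in
  n%:R^-1 * (\prod_(j in u) (b j - 1)^-1) *
  \sum_(i < n) \sum_(i' < n) \prod_(j in u)
    (b j * (same_cell (k j).+1 i i' j)%:R - (same_cell (k j) i i' j)%:R).

(* Main.v *)
Require Import Defs.
From HB Require Import structures.
From mathcomp Require Import all_boot all_order all_algebra.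
From mathcomp Require Import all_classical all_reals all_analysis.
From mathcomp Require Import ring.
Import Order.TTheory GRing.Theory Num.Theory.
Import numFieldNormedType.Exports.

Set Implicit Arguments.
Unset Strict Implicit.
Unset Printing Implicit Defensive.

Local Open Scope classical_set_scope.
Local Open Scope ring_scope.

(* For k = 0 only the first digits matter, so i and i' interact through their
   congruence modulo the bases. If q is not in u and p is its base, restricting
   to pairs congruent modulo p splits n p indices into p classes, each of which
   reproduces the weights of u on n indices; hence
     (p - 1) G_{u + q}(n p) = p G_u(n) - G_u(n p).
   With S = sup G_u, finite because the double sum cancels over a full period,
   and U = sup G_{u + q}, this gives p S <= (p - 1) U + S, that is S <= U. The
   coordinates missing from the smaller set are then added one at a time. *)

(** * The bases as pairwise coprime primes *)

Lemma next_primeP (m : nat) : (m < next_prime m)%N && prime (next_prime m).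
Proof. by rewrite /next_prime; case: ex_minnP. Qed.

Lemma nth_prime_prime (j : nat) : prime (nth_prime j).
Proof. by case: j => [//|j]; have /andP[] := next_primeP (nth_prime j). Qed.

Lemma ltn_nth_prime : {homo nth_prime : i j / (i < j)%N}.
Proof.
apply: homo_ltn ltn_trans _ => j.
by have /andP[] := next_primeP (nth_prime j).
Qed.

Lemma nth_prime_inj : injective nth_prime.
Proof.
move=> i j eq_ij; have [ltij|ltji|//] := ltngtP i j.
  by have := ltn_nth_prime ltij; rewrite eq_ij ltnn.
by have := ltn_nth_prime ltji; rewrite eq_ij ltnn.
Qed.

Lemma coprime_nth_prime (i j : nat) :
  i != j -> coprime (nth_prime i) (nth_prime j).
Proof.
move=> neq_ij; rewrite prime_coprime ?nth_prime_prime//.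
by rewrite dvdn_prime2 ?nth_prime_prime// (inj_eq nth_prime_inj).
Qed.

(** * Leading digits of radical inverses *)

Section RadicalInverse.
Variable R : realType.

Let terms (b i l : nat) : R := (digit b i l)%:R / b%:R ^+ l.+1.

(** Multiplication by [b] shifts the expansion: the first digit becomes the integer part, and the
    remaining digits are those of [i %/ b]. *)
Let radical_sum_rec b i n : (0 < b)%N ->
  b%:R * series (terms b i) n.+1
  = (i %% b)%:R + series (terms b (i %/ b)) n.
Proof.
move=> b0; have bN0 : b%:R != 0 :> R by rewrite pnatr_eq0 -lt0n.
rewrite /series /= big_nat_recl// mulrDr /terms; congr (_ + _).
  by rewrite /digit expn0 divn1 expr1 mulrCA divff ?mulr1.
rewrite mulr_sumr; apply: eq_bigr => l _.
rewrite /digit expnS divnMA mulrCA; congr (_ * _).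
by rewrite exprS invfM mulrA divff ?mul1r.
Qed.

Let radical_sum_bounds b i n : (0 < b)%N -> 0 <= series (terms b i) n < 1.
Proof.
move=> b0; have bR0 : 0 < b%:R :> R by rewrite ltr0n.
elim: n i => [|n IHn] i; first by rewrite /series /= big_nil lexx ltr01.
have /andP[lb ub] := IHn (i %/ b)%N.
rewrite -(pmulr_rge0 _ bR0) -(ltr_pM2l bR0 _ 1) mulr1 radical_sum_rec//.
(* The leading digit is at most [b - 1] and the shifted tail is below 1 by induction. *)
rewrite addr_ge0//=; apply: (@lt_le_trans _ _ ((i %% b)%:R + 1)).
  by rewrite ltrD2l.
by rewrite natr1 ler_nat ltn_pmod.
Qed.

(** The partial sums are eventually constant: for [l > i] one has [i < b ^ l], so digit [l] of [i]
    is zero. *)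
Let radical_inverseE b i : (1 < b)%N ->
  radical_inverse R b i = series (terms b i) i.+1.
Proof.
move=> b1; apply: lim_near_cst => //; exists i.+1 => // n /= lt_in.
rewrite /series /= (big_cat_nat _ lt_in)//=.
rewrite -[RHS]addr0; congr (_ + _).
rewrite big_nat_cond big1// => l /andP[/andP[lt_il _] _].
rewrite /digit divn_small ?mod0n ?mul0r//.
by apply: leq_ltn_trans (ltn_expl _ b1); apply: ltnW.
Qed.

Lemma floor_radical_inverse b i : (1 < b)%N ->
  Num.floor (radical_inverse R b i) = 0.
Proof.
move=> b1; apply: floor_def; rewrite radical_inverseE//.
by rewrite add0r; apply: radical_sum_bounds; apply: ltnW.
Qed.

Lemma floor_mul_radical_inverse b i : (1 < b)%N ->
  Num.floor (b%:R * radical_inverse R b i) = (i %% b)%N.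
Proof.
move=> b1; have b0 := ltnW b1; apply: floor_def.
rewrite (radical_inverseE _ b1) (radical_sum_rec _ _ b0).
have /andP[lb ub] := radical_sum_bounds (i %/ b) i b0.
by rewrite intrD -pmulrn lerDl ltrD2l lb.
Qed.

End RadicalInverse.

(** * Residues and sums over full periods *)

Lemma eqn_modMr (b a m n : nat) : coprime b a ->
  (m * a == n * a %[mod b]) = (m == n %[mod b]).
Proof.
(* Subtraction on naturals is truncated, so turning the congruence into a divisibility needs an
   order. *)
move=> cop; wlog le_mn : m n / (m <= n)%N.
  move=> W; have [/W//|/ltnW/W] := leqP m n.
  by rewrite eq_sym [RHS]eq_sym.
rewrite eq_sym [RHS]eq_sym !eqn_mod_dvd ?leq_mul2r ?le_mn ?orbT//.
by rewrite -mulnBl Gauss_dvdl.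
Qed.

Section PeriodicSums.
Variable V : zmodType.
Implicit Types F : nat -> V.

Lemma sum_ord_mul F (m p : nat) :
  \sum_(i < m * p) F i = \sum_(s < m) \sum_(r < p) F (s * p + r)%N.
Proof.
rewrite -(big_mkord predT F) big_nat_mul big_mkord; apply: eq_bigr => s _.
rewrite -(big_mkord predT (fun r => F (s * p + r)%N)).
by rewrite -{1}[(s * p)%N]add0n big_addn mulSn addnK; under eq_bigr do rewrite addnC.
Qed.

(** As [M] is invertible modulo [b], the map [s -> s * M + r] permutes the residues. *)
Lemma sum_modn_coprime F (M b r : nat) : (0 < b)%N -> coprime b M ->
  \sum_(s < b) F ((s * M + r) %% b)%N = \sum_(s < b) F s.
Proof.
move=> b0 cop; pose h (s : 'I_b) := Ordinal (ltn_pmod (s * M + r) b0).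
have h_inj : injective h.
  move=> s t /(congr1 val) /= /eqP; rewrite eqn_modDr eqn_modMr//.
  by rewrite !modn_small// => /eqP /val_inj.
by rewrite [RHS](reindex_inj h_inj).
Qed.

End PeriodicSums.

(** Full periods contribute zero, which leaves [n %% L < L] terms of size at most [K]. *)
Lemma periodic_sum_bound (R : realType) (F : nat -> R) (L : nat) (K : R) :
  (0 < L)%N -> (forall x y, x = y %[mod L] -> F x = F y) ->
  \sum_(i < L) F i = 0 -> (forall x, `|F x| <= K) ->
  forall n, `|\sum_(i < n) F i| <= L%:R * K.
Proof.
move=> L0 perF sumF0 leFK n.
have K0 : 0 <= K by apply: le_trans (leFK 0%N).
have -> : \sum_(i < n) F i = \sum_(i < n %/ L * L + n %% L) F i by rewrite -divn_eq.
rewrite big_split_ord /= sum_ord_mul big1 ?add0r => [|s _].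
  under eq_bigr do rewrite (perF _ _ (modnMDl _ _ _)).
  apply: le_trans (ler_norm_sum _ _ _) _.
  apply: (@le_trans _ _ (\sum_(i < n %% L) K)); first exact: ler_sum.
  by rewrite sumr_const card_ord -[leLHS]mulr_natl ler_wpM2r// ler_nat ltnW ?ltn_pmod.
by under eq_bigr do rewrite (perF _ _ (modnMDl _ _ _)).
Qed.

(** * Gain coefficients at [k = 0] as sums over congruences *)

Section CongruenceWeight.
Variables (R : realType) (d : nat).
Implicit Types (u v : {set 'I_d}) (i n : nat) (q : 'I_d).

Definition congruence_weight u i i' : R :=
  \prod_(j in u) ((nth_prime j)%:R * (i == i' %[mod nth_prime j])%:R - 1).

Definition weight_sum u n : R :=
  \sum_(i < n) \sum_(i' < n) congruence_weight u i i'.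

(** All coordinates lie in [[0, 1)], so the level-0 indicators equal 1; the level-1 indicators
    compare first digits, that is, residues modulo the bases. *)
Lemma gain0E u n :
  gain R u (fun=> 0%N) n
  = n%:R^-1 * (\prod_(j in u) ((nth_prime j)%:R - 1)^-1) * weight_sum u n.
Proof.
congr (_ * _); apply: eq_bigr => i _; apply: eq_bigr => i' _.
apply: eq_bigr => j _; have b1 := prime_gt1 (nth_prime_prime j).
rewrite !mxE expr1 expr0 !mul1r !floor_mul_radical_inverse//.
by rewrite !floor_radical_inverse// eqxx.
Qed.

Lemma congruence_weightU1 u q i i' : q \notin u ->
  congruence_weight (q |: u)%SET i i'
  = ((nth_prime q)%:R * (i == i' %[mod nth_prime q])%:R - 1)
    * congruence_weight u i i'.
Proof. by move=> qu; rewrite /congruence_weight big_setU1. Qed.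

Lemma congruence_weight_modr u i x y :
  x = y %[mod \prod_(j in u) nth_prime j] ->
  congruence_weight u i x = congruence_weight u i y.
Proof.
move=> eq_xy; apply: eq_bigr => j ju; congr (_ * (_ == _)%:R - _).
have dvd_j : (nth_prime j %| \prod_(j in u) nth_prime j)%N.
  by rewrite (bigD1 j) ?dvdn_mulr.
by rewrite -(modn_dvdm x dvd_j) eq_xy modn_dvdm.
Qed.

(** The shift by [r] cancels, and the base of [q] is invertible modulo every base of [u]. *)
Lemma congruence_weight_affine u q r i i' : q \notin u ->
  congruence_weight u (i * nth_prime q + r) (i' * nth_prime q + r)
  = congruence_weight u i i'.
Proof.
move=> qu; apply: eq_bigr => j ju; congr (_ * (nat_of_bool _)%:R - _).
have cop : coprime (nth_prime j) (nth_prime q).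
  by apply: coprime_nth_prime; apply: contraNneq qu => /val_inj <-.
by rewrite eqn_modDr eqn_modMr.
Qed.

Lemma norm_congruence_weight u i i' :
  `|congruence_weight u i i'| <= \prod_(j in u) ((nth_prime j)%:R + 1).
Proof.
rewrite normr_prod; apply: ler_prod => j _; rewrite normr_ge0/=.
apply: le_trans (ler_normB _ _) _; rewrite normr1 lerD2r normrM !normr_nat.
by rewrite ler_piMr// lern1 leq_b1.
Qed.

(* By the Chinese remainder theorem the factor at [q] can be averaged over its
   residues while the others stay fixed, and its average is zero. *)
Lemma congruence_weight_period_sum u i : u != finset.set0 ->
  \sum_(i' < \prod_(j in u) nth_prime j) congruence_weight u i i' = 0.
Proof.
case/set0Pn => q qu; set u' := (u :\ q)%SET; set b := nth_prime q.
have qu' : q \notin u' by rewrite !inE eqxx.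
have b0 : (0 < b)%N := prime_gt0 (nth_prime_prime q).
have cop : coprime b (\prod_(j in u') nth_prime j).
  elim/big_ind: _ => [|x y copx copy|j]; first exact: coprimen1.
    by rewrite coprimeMr copx.
  by rewrite !inE => /andP[jq _]; apply: coprime_nth_prime; rewrite eq_sym.
rewrite -(finset.setD1K qu) -/u' big_setU1//= sum_ord_mul exchange_big big1//= => r _.
under eq_bigr => s _.
  rewrite congruence_weightU1//.
  rewrite (@congruence_weight_modr u' i _ r) ?modnMDl//.
  over.
rewrite -mulr_suml -/b.
rewrite (sum_modn_coprime (fun x => b%:R * (i %% b == x)%N%:R - 1) r b0 cop).
rewrite sumrB -mulr_sumr sumr_const card_ord.
(* Only the residue of [i] meets the indicator, so the sum is [b * 1 - b = 0]. *)
rewrite (bigD1 (Ordinal (ltn_pmod i b0)))//= eqxx big1 => [|s].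
  by rewrite addr0 mulr1 subrr mul0r.
by move=> /negbTE; rewrite -val_eqE/= eq_sym => ->.
Qed.

(** For each [i] the inner sum over [i'] is bounded independently of [n]; the factor [1 / n] then
    averages these bounds over [i]. *)
Lemma gain0_bounded u : u != finset.set0 ->
  exists C : R, forall n, (0 < n)%N -> gain R u (fun=> 0%N) n <= C.
Proof.
move=> uN0; pose K : R := \prod_(j in u) ((nth_prime j)%:R + 1).
pose L := (\prod_(j in u) nth_prime j)%N.
pose P : R := \prod_(j in u) ((nth_prime j)%:R - 1)^-1.
have P0 : 0 <= P.
  by apply: prodr_ge0 => j _; rewrite invr_ge0 subr_ge0 ler1n prime_gt0 ?nth_prime_prime.
have L0 : (0 < L)%N by apply: prodn_gt0 => j; rewrite prime_gt0 ?nth_prime_prime.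
exists (P * (L%:R * K)) => n n0; rewrite gain0E -/P mulrAC mulrC ler_wpM2l//.
rewrite mulrC ler_pdivrMr ?ltr0n// mulr_natr.
rewrite -[X in _ *+ X]card_ord -sumr_const; apply: ler_sum => i _.
apply: le_trans (ler_norm _) _; apply: periodic_sum_bound => //.
- exact: congruence_weight_modr.
- exact: congruence_weight_period_sum.
- exact: norm_congruence_weight.
Qed.

(** The term [-1] of the factor at [q] yields the subtracted sum. The indicator keeps the pairs
    [s * p + r], [s' * p + r] with a common [r]; each of the [p] values of [r] gives a copy of
    [weight_sum u n]. *)
Lemma weight_sumU1 u q n : q \notin u ->
  let p := nth_prime q in
  weight_sum (q |: u)%SET (n * p) =
  p%:R * (p%:R * weight_sum u n) - weight_sum u (n * p).
Proof.
move=> qu p.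
pose F i i' := (i == i' %[mod p])%:R * congruence_weight u i i'.
transitivity (p%:R * (\sum_(i < n * p) \sum_(i' < n * p) F i i') - weight_sum u (n * p)).
  rewrite mulr_sumr -sumrB; apply: eq_bigr => i _.
  rewrite mulr_sumr -sumrB; apply: eq_bigr => i' _.
  by rewrite congruence_weightU1// mulrBl mul1r -mulrA.
congr (_ * _ - _).
under eq_bigr do rewrite (sum_ord_mul (F _)).
rewrite (sum_ord_mul (fun i => \sum_(s < n) \sum_(r < p) F i _)) mulr_sumr; apply: eq_bigr => s _.
transitivity (\sum_(r < p) \sum_(s' < n) congruence_weight u s s'); last first.
  by rewrite sumr_const card_ord mulr_natl.
apply: eq_bigr => r _; apply: eq_bigr => s' _.
rewrite (bigD1 r)//= /F eqn_modDr !modnMl eqxx mul1r congruence_weight_affine//.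
rewrite big1 ?addr0// => r' /negbTE neq_r; rewrite !modnMDl !modn_small//.
by rewrite val_eqE eq_sym neq_r mul0r.
Qed.

Lemma gain0U1 u q n : q \notin u ->
  let p := nth_prime q in
  (p%:R - 1) * gain R (q |: u)%SET (fun=> 0%N) (n * p)
  = p%:R * gain R u (fun=> 0%N) n - gain R u (fun=> 0%N) (n * p).
Proof.
move=> qu p; rewrite !gain0E big_setU1//= weight_sumU1// -/p.
have p1 : (1 < p)%N := prime_gt1 (nth_prime_prime q).
have pN0 : p%:R != 0 :> R by rewrite pnatr_eq0 -lt0n ltnW.
have pN1 : p%:R - 1 != 0 :> R by rewrite subr_eq0 pnatr_eq1 gtn_eqF.
rewrite natrM invfM; set P := \prod_(j in u) _.
(* Regrouping exposes the two cancellations as quotients: [p - 1] against the normalisation at [q],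
   and one factor [p] against [1 / (n p)]. *)
have -> : (p%:R - 1) * (n%:R^-1 * p%:R^-1 * ((p%:R - 1)^-1 * P) *
    (p%:R * (p%:R * weight_sum u n) - weight_sum u (n * p))) =
  ((p%:R - 1) / (p%:R - 1)) * (p%:R / p%:R * (p%:R * (n%:R^-1 * P * weight_sum u n))
     - n%:R^-1 * p%:R^-1 * P * weight_sum u (n * p)) by ring.
by rewrite !divff// !mul1r.
Qed.

Lemma gain0_ub_U1 u q (U : R) : u != finset.set0 -> q \notin u ->
  (forall n, (0 < n)%N -> gain R (q |: u)%SET (fun=> 0%N) n <= U) ->
  forall n, (0 < n)%N -> gain R u (fun=> 0%N) n <= U.
Proof.
move=> uN0 qu leU; have [C leC] := gain0_bounded uN0.
pose A := [set gain R u (fun=> 0%N) n | n in [set n : nat | (0 < n)%N]].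
(* A real [sup] is meaningful only for a non-empty bounded set; [C] supplies the bound. *)
have ubA : has_ubound A by exists C => _ [n n0 <-]; exact: leC.
have le_sup n : (0 < n)%N -> gain R u (fun=> 0%N) n <= sup A.
  by move=> n0; apply: ub_le_sup => //; exists n.
pose p := nth_prime q.
have p1 : (1 < p)%N := prime_gt1 (nth_prime_prime q).
have pR1 : 1 < p%:R :> R by rewrite ltr1n.
have supA : sup A <= ((p%:R - 1) * U + sup A) / p%:R.
  apply: ge_sup; first by exists (gain R u (fun=> 0%N) 1); exists 1%N.
  move=> _ [n n0 <-].
  have np0 : (0 < n * p)%N by rewrite muln_gt0 n0 ltnW.
  rewrite ler_pdivlMr ?(lt_trans ltr01)// mulrC.
  have /eqP := gain0U1 n qu; rewrite -/p eq_sym subr_eq => /eqP ->.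
  by rewrite lerD ?le_sup// ler_wpM2l ?leU// subr_ge0 ltW.
suff : sup A <= U by move=> AU n n0; exact: le_trans (le_sup n n0) AU.
(* Subtracting the real number [sup A] leaves [(p - 1) sup A <= (p - 1) U], where [p - 1 > 0]. *)
move: supA; rewrite ler_pdivlMr ?(lt_trans ltr01)// -lerBlDr.
by rewrite -{2}[sup A]mulr1 -mulrBr mulrC ler_pM2l// subr_gt0.
Qed.

(** Induction on the number of coordinates in [u] missing from [v]: the bound passes from [u] to [v]
    with one of them added, then to [v]. *)
Lemma gain0_ub_subset u v (U : R) : v != finset.set0 -> v \subset u ->
  (forall n, (0 < n)%N -> gain R u (fun=> 0%N) n <= U) ->
  forall n, (0 < n)%N -> gain R v (fun=> 0%N) n <= U.
Proof.
move=> vN0 sub_vu leU; move: {2}#|_| (erefl #|u :\: v|) => k.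
elim: k v vN0 sub_vu => [|k IHk] v vN0 sub_vu.
  move=> /eqP; rewrite cards_eq0 finset.setD_eq0 => sub_uv.
  suff -> : v = u by [].
  by apply/eqP; rewrite finset.eqEsubset sub_vu.
move=> card_uv; have /set0Pn[q] : (u :\: v != finset.set0)%SET.
  by rewrite -cards_eq0 card_uv.
rewrite !inE => /andP[qv qu]; apply: (gain0_ub_U1 vN0 qv).
apply: IHk.
- by apply/set0Pn; exists q; rewrite !inE eqxx.
- by rewrite finset.subUset finset.sub1set qu.
- move: card_uv; rewrite (cardsD1 q) !inE qv qu add1n => -[<-].
  by rewrite finset.setDDl finset.setUC.
Qed.

End CongruenceWeight.

Theorem theorem2 (R : realType) (d : nat) (u v : {set 'I_d}) :
  (1 <= d)%N -> v != finset.set0 -> v \subset u ->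
  (ereal_sup [set (gain R v (fun=> 0%N) n)%:E | n in [set n : nat | (1 <= n)%N]]
   <= ereal_sup [set (gain R u (fun=> 0%N) n)%:E | n in [set n : nat | (1 <= n)%N]])%E.
Proof.
move=> _ vN0 sub_vu; apply: ge_ereal_sup => _ [n n1 <-].
set s := ereal_sup _.
have le_s m : (0 < m)%N -> ((gain R u (fun=> 0%N) m)%:E <= s)%E.
  by move=> m0; rewrite /s; apply: ereal_sup_ubound; exists m.
(* A finite [s] is a real upper bound that descends to [v]; [-oo] is excluded since [s] dominates a
   real gain. *)
case: s le_s => [U| |] le_s.
- by rewrite lee_fin; apply: (gain0_ub_subset vN0 sub_vu) n1 => m /le_s.
- by rewrite leey.
- by have := le_s _ n1.
Qed.
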